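(* Let $p$ be any odd prime and let $\mathbb{F}_p(x,y)$ be the field of rational functions in two independent variables over $\mathbb{F}_p$. Then the following matrices $A,B,C,D\in SL(2,\mathbb{F}_p(x,y))$ generate a faithful representation of the genus $2$ surface group, where $ABA^{-1}B^{-1}=DCD^{-1}C^{-1}$: \[ A=\begin{pmatrix} \frac{1-2x^2-2x^3}{x(x-1)}&\frac{-1+2x^2+x^3+x^4}{x^3(1-x)}\\ 1&\frac{1}{x^2}\end{pmatrix},\qquad B=\begin{pmatrix} \frac{x^2-1}{x-2x^3-2x^4}&\frac{1+2x-x^2-3x^3-2x^4}{x^2(2x^3+2x^2-1)}\\ x&1+x\end{pmatrix}, \] \[ D=\begin{pmatrix} \frac{1-2x^2-2x^3}{x(x-1)}&\frac{-1+2x^2+x^3+x^4}{yx^3(1-x)}\\ y&\frac{1}{x^2}\end{pmatrix},\qquad C=\begin{pmatrix} \frac{x^2-1}{x-2x^3-2x^4}&\frac{1+2x-x^2-3x^3-2x^4}{yx^2(2x^3+2x^2-1)}\\ yx&1+x\end{pmatrix}. \] That is, $a\mapsto A$, $b\mapsto B$, $c\mapsto C$, $d\mapsto D$ defines an injective homomorphism from $S_2=\langle a,b,c,d\mid [a,b][c,d]\rangle$ to $SL(2,\mathbb{F}_p(x,y))$.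
   Context: $S_2$ is the fundamental group of the closed orientable surface of genus $2$, and $[u,v]=uvu^{-1}v^{-1}$. *)

(* Defs.v *)
From HB Require Import structures.
From mathcomp Require Import all_boot all_order all_algebra.
From mathcomp Require Import monoid generic_quotient fraction boolp.

Set Implicit Arguments.
Unset Strict Implicit.
Unset Printing Implicit Defensive.

Import GRing.Theory.

Local Open Scope group_scope.

(* The group < I | rels > presented by generators I and relators rels, as the
   quotient of the monoid of words by the congruence generated by free
   cancellation and r ~ 1 for r in rels. The letter (i, false) stands for the
   generator i and (i, true) for its formal inverse. *)
Section Words.
Variable I : choiceType.

Definition word := seq (I * bool).

Definition wgen (i : I) : word := [:: (i, false)].
Definition winv (w : word) : word := rev [seq (l.1, ~~ l.2) | l <- w].
Definition wcomm (u v : word) : word := u ++ v ++ winv u ++ winv v.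

Variable rels : seq word.

Inductive weq : word -> word -> Prop :=
| weq_refl w : weq w w
| weq_sym u v : weq u v -> weq v u
| weq_trans v u w : weq u v -> weq v w -> weq u w
| weq_cat u u' v v' : weq u u' -> weq v v' -> weq (u ++ v) (u' ++ v')
| weq_cancel i b : weq [:: (i, b); (i, ~~ b)] [::]
| weq_rel r : r \in rels -> weq r [::].

Definition weqb (u v : word) : bool := `[< weq u v >].

Lemma weqb_refl : reflexive weqb.
Proof. by move=> w; apply/asboolP/weq_refl. Qed.

Lemma weqb_sym : symmetric weqb.
Proof. by move=> u v; apply/asboolP/asboolP => /weq_sym. Qed.

Lemma weqb_trans : transitive weqb.
Proof.
by move=> v u w /asboolP uv /asboolP vw; apply/asboolP/(weq_trans uv).
Qed.

Canonical weqb_equiv := EquivRel weqb weqb_refl weqb_sym weqb_trans.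

Definition pres := {eq_quot weqb}%qT.

HB.instance Definition _ := Choice.on pres.

Definition pcls (w : word) : pres := (\pi_{eq_quot weqb} w)%qT.

Definition pgen (i : I) : pres := pcls (wgen i).

Lemma pclsP u v : pcls u = pcls v <-> weq u v.
Proof.
split => [/eqP|uv]; first by rewrite eqmodE => /asboolP.
by apply/eqP; rewrite eqmodE; apply/asboolP.
Qed.

Lemma pcls_ind (P : pres -> Prop) : (forall w, P (pcls w)) -> forall g, P g.
Proof. by move=> Pw; apply: quotW. Qed.

Lemma weq_repr w : weq (repr (pcls w)) w.
Proof. by apply/pclsP; rewrite /pcls reprK. Qed.

Lemma winv_cat u v : winv (u ++ v) = winv v ++ winv u.
Proof. by rewrite /winv map_cat rev_cat. Qed.

Lemma winvK : involutive winv.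
Proof.
move=> w; rewrite /winv map_rev revK -map_comp map_id_in // => -[i b] _ /=.
by rewrite negbK.
Qed.

Lemma weq_winvr w : weq (w ++ winv w) [::].
Proof.
elim: w => [|[i b] w IHw]; first exact: weq_refl.
rewrite -cat1s winv_cat -catA (catA w).
apply: (@weq_trans ([:: (i, b)] ++ ([::] ++ winv [:: (i, b)]))).
  apply: weq_cat; first exact: weq_refl.
  by apply: weq_cat => //; apply: weq_refl.
exact: weq_cancel.
Qed.

Lemma weq_winvl w : weq (winv w ++ w) [::].
Proof. by rewrite -{2}(winvK w); apply: weq_winvr. Qed.

Lemma weq_inv u v : weq u v -> weq (winv u) (winv v).
Proof.
move=> uv; apply: (@weq_trans (winv u ++ (v ++ winv v))).
  rewrite -{1}[winv u]cats0; apply: weq_cat; first exact: weq_refl.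
  exact/weq_sym/weq_winvr.
rewrite catA -[X in weq _ X]cat0s; apply: weq_cat; last exact: weq_refl.
apply: weq_trans (weq_winvl u); apply: weq_cat; first exact: weq_refl.
exact: weq_sym.
Qed.

Definition pone : pres := pcls [::].
Definition pmul (g h : pres) : pres := pcls (repr g ++ repr h).
Definition pinv (g : pres) : pres := pcls (winv (repr g)).

Lemma pmulE u v : pmul (pcls u) (pcls v) = pcls (u ++ v).
Proof. by apply/pclsP; apply: weq_cat; apply: weq_repr. Qed.

Lemma pinvE w : pinv (pcls w) = pcls (winv w).
Proof. by apply/pclsP; apply: weq_inv; apply: weq_repr. Qed.

Lemma pmulA : associative pmul.
Proof.
elim/pcls_ind=> u; elim/pcls_ind=> v; elim/pcls_ind=> w.
by rewrite !pmulE catA.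
Qed.

Lemma pmul1 : left_id pone pmul.
Proof. by elim/pcls_ind=> w; rewrite pmulE. Qed.

Lemma pmulr1 : right_id pone pmul.
Proof. by elim/pcls_ind=> w; rewrite pmulE cats0. Qed.

Lemma pmulV : left_inverse pone pinv pmul.
Proof. by elim/pcls_ind=> w; rewrite pinvE pmulE; apply/pclsP/weq_winvl. Qed.

Lemma pmulrV : right_inverse pone pinv pmul.
Proof. by elim/pcls_ind=> w; rewrite pinvE pmulE; apply/pclsP/weq_winvr. Qed.

HB.instance Definition _ :=
  isGroup.Build pres pmulA pmul1 pmulr1 pmulV pmulrV.

Lemma pclsM u v : pcls (u ++ v) = pcls u * pcls v.
Proof. by rewrite -pmulE. Qed.

Lemma pclsV w : pcls (winv w) = (pcls w)^-1.
Proof. by rewrite -pinvE. Qed.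

Section Eval.
Variables (G : groupType) (f : I -> G).

Definition weval (w : word) : G :=
  \prod_(l <- w) (if l.2 then (f l.1)^-1 else f l.1).

Lemma weval_cat u v : weval (u ++ v) = weval u * weval v.
Proof. exact: big_cat. Qed.

Lemma weval_gen i : weval (wgen i) = f i.
Proof. by rewrite /weval big_seq1. Qed.

Lemma weval_inv w : weval (winv w) = (weval w)^-1.
Proof.
elim: w => [|[i b] w IHw]; first by rewrite /weval !big_nil invg1.
rewrite -cat1s winv_cat !weval_cat IHw invgM; congr (_ * _).
by rewrite /weval !big_seq1 /=; case: b; rewrite //= invgK.
Qed.

Hypothesis f_rels : {in rels, forall r, weval r = 1}.

Lemma weval_weq u v : weq u v -> weval u = weval v.
Proof.
elim=> //= [? ? ? _ -> //|? ? ? ? _ IHu _ IHv|i b|r r_rels].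
- by rewrite !weval_cat IHu IHv.
- by rewrite /weval big_cons big_seq1 big_nil; case: b; rewrite /= ?mulgV ?mulVg.
- by rewrite f_rels // /weval big_nil.
Qed.

Lemma pres_universal :
  exists! phi : pres -> G,
    {morph phi : g h / g * h} /\ (forall i, phi (pgen i) = f i).
Proof.
pose phi (g : pres) := weval (repr g).
have phiE w : phi (pcls w) = weval w by exact/weval_weq/weq_repr.
exists phi; split=> [|psi [psiM psi_gen]].
  split=> [|i]; last by rewrite /pgen phiE weval_gen.
  elim/pcls_ind=> u; elim/pcls_ind=> v.
  by rewrite -pclsM !phiE weval_cat.
have psi1 : psi 1 = 1 by apply: (mulgI (psi 1)); rewrite -psiM !mulg1.
have psiV g : psi g^-1 = (psi g)^-1.
  by apply: (mulgI (psi g)); rewrite -psiM !mulgV psi1.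
apply/funext; elim/pcls_ind=> w; rewrite phiE.
elim: w => [|[i b] w IHw]; first by rewrite /weval big_nil.
rewrite -cat1s weval_cat pclsM psiM IHw; congr (_ * _).
case: b; last by rewrite -/(wgen i) weval_gen -psi_gen.
rewrite -[[:: _]]/(winv (wgen i)) weval_inv weval_gen pclsV psiV.
by rewrite -psi_gen.
Qed.

End Eval.

End Words.

Section SurfaceGroup.

Definition gen_a : 'I_4 := @Ordinal 4 0 isT.
Definition gen_b : 'I_4 := @Ordinal 4 1 isT.
Definition gen_c : 'I_4 := @Ordinal 4 2 isT.
Definition gen_d : 'I_4 := @Ordinal 4 3 isT.

Definition S2_rels : seq (word 'I_4) :=
  [:: wcomm (wgen gen_a) (wgen gen_b) ++ wcomm (wgen gen_c) (wgen gen_d)].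

Definition S2 : groupType := pres S2_rels.

Definition S2a : S2 := pgen S2_rels gen_a.
Definition S2b : S2 := pgen S2_rels gen_b.
Definition S2c : S2 := pgen S2_rels gen_c.
Definition S2d : S2 := pgen S2_rels gen_d.

Lemma S2_relation :
  (S2a * S2b * S2a^-1 * S2b^-1) * (S2c * S2d * S2c^-1 * S2d^-1) = 1.
Proof.
have /pclsP : weq S2_rels (wcomm (wgen gen_a) (wgen gen_b)
                           ++ wcomm (wgen gen_c) (wgen gen_d)) [::].
  by apply: weq_rel; rewrite inE.
by rewrite /wcomm !(pclsM, pclsV) !mulgA.
Qed.

End SurfaceGroup.

Local Open Scope ring_scope.

Section SpecialLinear.
Variables (n : nat) (R : comUnitRingType).

Record SL := MkSL { slval :> 'M[R]_n; _ : \det slval == 1 }.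

HB.instance Definition _ := [isSub for slval].
HB.instance Definition _ := [Choice of SL by <:].

Implicit Types M N : SL.

Lemma SL_det M : \det M = 1. Proof. by case: M => M /= /eqP. Qed.

Lemma SL_unit M : (M : 'M_n) \in unitmx.
Proof. by rewrite unitmxE SL_det unitr1. Qed.

Lemma SL_one_subproof : \det (1%:M : 'M[R]_n) == 1.
Proof. by rewrite det1. Qed.

Lemma SL_mul_subproof M N : \det (M *m N) == 1.
Proof. by rewrite det_mulmx !SL_det mulr1. Qed.

Lemma SL_inv_subproof M : \det (invmx M) == 1.
Proof. by rewrite det_inv SL_det invr1. Qed.

Definition SL_one : SL := MkSL SL_one_subproof.
Definition SL_mul M N : SL := MkSL (SL_mul_subproof M N).
Definition SL_inv M : SL := MkSL (SL_inv_subproof M).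

Lemma SL_mulA : associative SL_mul.
Proof. by move=> M N P; apply: val_inj; rewrite /= mulmxA. Qed.

Lemma SL_mul1 : left_id SL_one SL_mul.
Proof. by move=> M; apply: val_inj; rewrite /= mul1mx. Qed.

Lemma SL_mulr1 : right_id SL_one SL_mul.
Proof. by move=> M; apply: val_inj; rewrite /= mulmx1. Qed.

Lemma SL_mulV : left_inverse SL_one SL_inv SL_mul.
Proof. by move=> M; apply: val_inj; rewrite /= mulVmx ?SL_unit. Qed.

Lemma SL_mulrV : right_inverse SL_one SL_inv SL_mul.
Proof. by move=> M; apply: val_inj; rewrite /= mulmxV ?SL_unit. Qed.

HB.instance Definition _ :=
  isGroup.Build SL SL_mulA SL_mul1 SL_mulr1 SL_mulV SL_mulrV.

End SpecialLinear.

Definition mx2 (R : Type) (a b c d : R) : 'M[R]_2 :=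
  \matrix_(i < 2, j < 2)
    if i == 0 then (if j == 0 then a else b) else (if j == 0 then c else d).

(* k(x, y), as the fraction field of k[x][y]. *)
Definition ratfun2 (k : fieldType) : fieldType := {fraction {poly {poly k}}}.

Definition ratX (k : fieldType) : ratfun2 k := tofrac ('X%:P).
Definition ratY (k : fieldType) : ratfun2 k := tofrac 'X.

(* Main.v *)
(* Write K = F_p(x, y) and T = diag(1, y). Then D = T A T^-1 and
   C = T B T^-1, and [A, B] = diag(l, 1/l) with l = x(1-2x^2-2x^3)/(x-1), so
   that [A, B] commutes with T; S_2 is the amalgam of the free groups <a, b>
   and <d, c> along [a, b] = [d, c].
   - For the x-degree, A, B and their inverses play ping-pong with four discs
     of the projective line (this uses 2 <> 0). The points at infinity and 0,
     fixed by [A, B], lie in the limit set and have a periodic itinerary of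
     period 4. Comparing itineraries, a word in A and B which fixes one of these
     points, i.e. which is a triangular matrix, is a power of [a, b].
   - For the y-degree, an element of <A, B> with nonzero (0,1) entry maps the
     vectors (u, v) with deg u < deg v to vectors with deg v <= deg u, u <> 0,
     and an element of T <A, B> T^-1 with nonzero (1,0) entry maps the latter
     to the former. This is ping-pong for an amalgam, so the kernel lies in
     <a, b>; its elements are triangular, hence powers of [a, b], and l is not
     a root of unity. *)
From HB Require Import structures.
From mathcomp Require Import all_boot all_order all_algebra.
From mathcomp Require Import monoid generic_quotient fraction polyXY boolp.
From mathcomp Require Import ring zify.
Require Import Defs.

Set Implicit Arguments.
Unset Strict Implicit.
Unset Printing Implicit Defensive.

Import GRing.Theory.
Local Open Scope ring_scope.

(** * Valuations *)

(* le a b stands for v(a) >= v(b), where v is a valuation of K. *)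
Record valuation_preorder (K : fieldType) (le : rel K) : Prop := {
  vle_total : total le;
  vle_trans : transitive le;
  vleM2r : forall c a b, le a b -> le (a * c) (b * c);
  vleD : forall c a b, le a c -> le b c -> le (a + b) c;
  vle10 : ~~ le 1 0
}.

Section ValuationPreorder.
Variables (K : fieldType) (le : rel K) (leP : valuation_preorder le).

Local Notation lt a b := (~~ le b a).

Lemma vle_refl : reflexive le.
Proof. by move=> a; case/orP: (vle_total leP a a). Qed.

Lemma vltW a b : lt a b -> le a b.
Proof. by case/orP: (vle_total leP a b) => // ->. Qed.

Lemma vle_lt_trans b a c : le a b -> lt b c -> lt a c.
Proof. by move=> ab; apply: contra => ca; apply: (vle_trans leP ca). Qed.

Lemma vlt_le_trans b a c : lt a b -> le b c -> lt a c.
Proof. by move=> ab bc; apply: contra ab => /(vle_trans leP bc). Qed.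

Lemma vle0 a : le 0 a.
Proof.
have /(vleM2r leP a) : le 0 1 by apply: vltW (vle10 leP).
by rewrite mul0r mul1r.
Qed.

Lemma vlt0 a : lt 0 a = (a != 0).
Proof.
congr (~~ _); apply/idP/eqP => [a0|->]; last exact: vle0.
apply/eqP; apply: contraT => nz.
by have := vleM2r leP a^-1 a0; rewrite divff // mul0r (negPf (vle10 leP)).
Qed.

Lemma vle_eq0 a : le a 0 -> a = 0.
Proof. by move=> a0; apply/eqP; rewrite -[_ == _]negbK -vlt0 a0. Qed.

Lemma vleN a b : le (- a) b = le a b.
Proof.
have leN1 : le (- 1) 1.
  case/orP: (vle_total leP (- 1) 1) => // /(vleM2r leP (- 1)).
  by rewrite mulrNN !mul1r.
have leN c d : le c d -> le (- c) d.
  by apply: (vle_trans leP); rewrite -mulN1r -{2}[c]mul1r (vleM2r leP).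
by apply/idP/idP => [/leN|/leN]; rewrite ?opprK.
Qed.

Lemma vleNr a b : le a (- b) = le a b.
Proof.
by rewrite -vleN; apply/idP/idP => /(vleM2r leP (- 1)); rewrite !mulrN1 ?opprK.
Qed.

Lemma vltD a b c : lt a c -> lt b c -> lt (a + b) c.
Proof.
move=> ac bc; case/orP: (vle_total leP a b) => ab.
  by apply: (vle_lt_trans _ bc); apply: (vleD leP) => //; apply: vle_refl.
by apply: (vle_lt_trans _ ac); apply: (vleD leP) => //; apply: vle_refl.
Qed.

Lemma vleM a b c d : le a b -> le c d -> le (a * c) (b * d).
Proof.
move=> ab cd; apply: (vle_trans leP (vleM2r leP c ab)).
by rewrite ![b * _]mulrC (vleM2r leP).
Qed.

Lemma vleM2rE c a b : c != 0 -> le (a * c) (b * c) = le a b.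
Proof.
move=> nz; apply/idP/idP => [/(vleM2r leP c^-1)|]; last exact: vleM2r.
by rewrite !mulfK.
Qed.

Lemma vle_nat n : le n%:R 1.
Proof.
elim: n => [|n IHn]; first exact: vle0.
by rewrite mulrS (vleD leP) ?vle_refl.
Qed.

(** If [a + b] were strictly below [b], then [b = - a + (a + b)] would be a sum of two terms
    strictly below [b]. *)
Lemma vle_lead a b : lt a b -> le b (a + b).
Proof.
move=> ab; apply: contraT => abb; have : lt b b.
  by rewrite -{2}[b](addKr a) vltD ?vleNr.
by rewrite vle_refl.
Qed.

Section Powers.
Variables (x : K) (lt1x : lt 1 x).

Lemma vlt1_neq0 : x != 0.
Proof. by rewrite -vlt0 (vle_lt_trans _ lt1x) ?vle0. Qed.

Lemma vle_exp i j : (i <= j)%N -> le (x ^+ i) (x ^+ j).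
Proof.
move/subnK <-; elim: (j - i)%N => [|k IHk]; first exact: vle_refl.
by rewrite addSn exprS -[x ^+ i]mul1r vleM // vltW.
Qed.

Lemma vlt_exp i j : (i < j)%N -> lt (x ^+ i) (x ^+ j).
Proof.
move=> ij; apply: (vlt_le_trans (b := x ^+ i.+1)); last exact: vle_exp.
by rewrite exprS -{2}[x ^+ i]mul1r vleM2rE // expf_neq0 // vlt1_neq0.
Qed.

Lemma vexp_inj : injective (fun n => x ^+ n).
Proof.
by move=> m n eqx; case: (ltngtP m n) => // /vlt_exp; rewrite eqx vle_refl.
Qed.

(** Integers are at most [1] in the preorder, so the exponent of [x] decides. This estimate disposes
    of each lower term of an expanded matrix entry. *)
Lemma vlt_monomial k i n a w : w != 0 -> le a w -> (i < n)%N ->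
  lt (k%:R * x ^+ i * a) (x ^+ n * w).
Proof.
move=> w0 aw lt_in; apply: (vle_lt_trans (b := x ^+ i * w)).
  by apply: vleM => //; rewrite -[x in le _ x]mul1r vleM ?vle_nat ?vle_refl.
by rewrite vleM2rE ?vlt_exp.
Qed.

End Powers.

End ValuationPreorder.

(** * Degree valuations on a fraction field *)

Section FractionValuation.
Variables (R : idomainType) (sz : R -> nat).
Hypothesis sz_eq0 : forall p, (sz p == 0)%N = (p == 0).
Hypothesis szM : forall p q, p != 0 -> q != 0 -> sz (p * q) = (sz p + sz q).-1.
Hypothesis szD : forall p q, (sz (p + q) <= maxn (sz p) (sz q))%N.

(** Here [sz] behaves like the degree plus one, with [sz 0 = 0]. Comparing numerators over a common
    denominator avoids negative degrees and a degree of [0]. *)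
Definition frac_le (a b : {fraction R}) : bool :=
  `[< exists p q r : R, [/\ r != 0, a = tofrac p / tofrac r,
                            b = tofrac q / tofrac r & (sz p <= sz q)%N] >].

Lemma frac_common (a b c : {fraction R}) : exists p q s r : R,
  [/\ r != 0, a = tofrac p / tofrac r, b = tofrac q / tofrac r
    & c = tofrac s / tofrac r].
Proof.
have fracE (d : {fraction R}) : exists p r : R,
    r != 0 /\ d = tofrac p / tofrac r.
  elim/quotW: d => f; exists \n_f, \d_f; split; first exact: denom_ratioP.
  have f0 := denom_ratioP f.
  apply: (canRL (mulfK _)); rewrite ?tofrac_eq0 //.
  rewrite -[_ * _]/(FracField.mul _ _) !piE; apply/eqmodP.
  rewrite /= FracField.equivfE /FracField.mulf.
  by rewrite !numden_Ratio ?(oner_eq0, mulf_neq0, mulr1, f0) // mulrC.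
have [p [d [d0 ->]]] := fracE a; have [q [e [e0 ->]]] := fracE b.
have [s [f [f0 ->]]] := fracE c.
exists (p * e * f), (q * d * f), (s * d * e), (d * e * f).
split; first by rewrite !mulf_neq0.
- rewrite -mulrA -[d * e * f]mulrA !tofracM -mulf_div divff ?mulr1 //.
  by rewrite !mulf_neq0 ?tofrac_eq0.
- rewrite [d * e]mulrC -mulrA -[e * d * f]mulrA !tofracM -mulf_div divff ?mulr1 //.
  by rewrite !mulf_neq0 ?tofrac_eq0.
- rewrite [d * e * f]mulrC -[s * d * e]mulrA !tofracM -mulf_div divff ?mulr1 //.
  by rewrite !mulf_neq0 ?tofrac_eq0.
Qed.

Let sz0 : sz 0 = 0%N.
Proof. by apply/eqP; rewrite sz_eq0. Qed.

Lemma leq_szM2r r p q : r != 0 -> (sz (p * r) <= sz (q * r))%N = (sz p <= sz q)%N.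
Proof.
move=> r0; have [->|p0] := eqVneq p 0.
  by rewrite mul0r sz0.
have [->|q0] := eqVneq q 0.
  by rewrite mul0r sz0 !leqn0 !sz_eq0 mulf_eq0 (negPf r0) orbF.
(* Nonzero elements have positive [sz], so the predecessor in [szM] does not truncate. *)
rewrite !szM //; move: p0 q0 r0; rewrite -!sz_eq0; lia.
Qed.

(** Another denominator [r'] gives the same answer: [p * r'] and [q * r'] equal [p' * r] and
    [q' * r], and nonzero factors preserve the comparison. *)
Lemma frac_leE r p q : r != 0 ->
  frac_le (tofrac p / tofrac r) (tofrac q / tofrac r) = (sz p <= sz q)%N.
Proof.
move=> r0; apply/asboolP/idP => [[p' [q' [r' [r'0 ep eq]]]]|]; last first.
  by exists p, q, r.
have cross s s' : tofrac s / tofrac r = tofrac s' / tofrac r' -> s * r' = s' * r.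
  move/eqP; rewrite eqr_div ?tofrac_eq0 // -!tofracM tofrac_eq => /eqP //.
by rewrite -(leq_szM2r _ _ r0) -(cross _ _ ep) -(cross _ _ eq) leq_szM2r.
Qed.

Lemma frac_leP : valuation_preorder frac_le.
Proof.
split=> [a b|b a c|c a b|c a b|].
- have [p [q [_ [r [r0 -> -> _]]]]] := frac_common a b 0.
  by rewrite !frac_leE // leq_total.
- have [p [q [s [r [r0 -> -> ->]]]]] := frac_common a b c.
  by rewrite !frac_leE //; apply: leq_trans.
- have [p [q [s [r [r0 -> -> ->]]]]] := frac_common a b c.
  have [->|s0] := eqVneq s 0.
    rewrite tofrac0 !(mulr0, mul0r) => _; apply/asboolP; exists 0, 0, 1.
    by rewrite oner_eq0 tofrac0 mul0r.
  by rewrite !mulf_div -!tofracM !frac_leE ?mulf_neq0 // leq_szM2r.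
- have [p [q [s [r [r0 -> -> ->]]]]] := frac_common a b c.
  rewrite -mulrDl -tofracD !frac_leE // => ps qs.
  by rewrite (leq_trans (szD p q)) // geq_max ps.
- rewrite -[1]divr1 -[0](mul0r 1^-1) -(@tofrac0 R) -(@tofrac1 R).
  by rewrite frac_leE ?oner_eq0 // sz0 leqn0 sz_eq0 oner_eq0.
Qed.

Lemma frac_le_tofrac p q : frac_le (tofrac p) (tofrac q) = (sz p <= sz q)%N.
Proof.
by rewrite -[tofrac p]divr1 -[tofrac q]divr1 -tofrac1 frac_leE ?oner_eq0.
Qed.

End FractionValuation.

(** * Ping-pong *)

Section ReducedWords.
Variable I : choiceType.

Definition linv (l : I * bool) := (l.1, ~~ l.2).

Lemma linvK : involutive linv.
Proof. by case=> i b; rewrite /linv /= negbK. Qed.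

Definition reduced : word I -> bool := sorted (fun l k => k != linv l).

(** With no relators, [weq] is equality in the free group. Letters are added on the left, and cancel
    the head when it is their inverse. *)
Lemma weq_reduced (w : word I) : exists2 u, reduced u & weq [::] w u.
Proof.
elim: w => [|l w [[|k u] red_u wu]]; first by exists [::] => //; apply: weq_refl.
  exists [:: l] => //; rewrite -cat1s -[X in weq _ _ X](cats0 [:: l]).
  by apply: weq_cat => //; apply: weq_refl.
have [ek|nk] := eqVneq k (linv l); last first.
  exists [:: l, k & u]; first by rewrite /reduced /= nk.
  rewrite -cat1s -[X in weq _ _ X]cat1s.
  by apply: weq_cat => //; apply: weq_refl.
exists u; first exact: path_sorted red_u.
apply: (@weq_trans _ _ ([:: l; k] ++ u)).
  rewrite -cat1s -[[:: l; k]]/([:: l] ++ [:: k]) -catA; apply: weq_cat => //.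
  exact: weq_refl.
rewrite -[X in weq _ _ X]cat0s; apply: weq_cat; last exact: weq_refl.
by rewrite ek; case: l {ek} => i b; apply: weq_cancel.
Qed.

End ReducedWords.

Section PingPong.
Variables (I : choiceType) (H : groupType) (V : Type) (act : H -> V -> V).
Hypothesis act1 : forall v, act 1%g v = v.
Hypothesis actM : forall g h v, act (g * h)%g v = act g (act h v).
Variables (m : I -> H) (nz : V -> Prop) (D : I * bool -> V -> Prop).
Hypothesis D_nz : forall l v, D l v -> nz v.
Hypothesis D_inj : forall l k v, D l v -> D k v -> l = k.
Hypothesis D_act : forall l v,
  nz v -> ~ D (linv l) v -> D l (act (weval m [:: l]) v).

Lemma weval_cons (G : groupType) (f : I -> G) l w :
  weval f (l :: w) = (weval f [:: l] * weval f w)%g.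
Proof. by rewrite -cat1s weval_cat. Qed.

Lemma weval_linv (G : groupType) (f : I -> G) l :
  weval f [:: linv l] = (weval f [:: l])^-1%g.
Proof. by rewrite -weval_inv. Qed.

(** The image under the tail [k :: w] lies in [D k], which is disjoint from [D (linv l)] because [k]
    differs from [linv l]. *)
Lemma ping_pong l w v : reduced (l :: w) -> nz v -> ~ D (linv (last l w)) v ->
  D l (act (weval m (l :: w)) v).
Proof.
elim: w l => [|k w IHw] l; first by move=> _; apply: D_act.
rewrite {1}/reduced /= => /andP[nkl red_w] nz_v last_v.
have Dk := IHw k red_w nz_v last_v.
rewrite weval_cons actM; apply: D_act; first exact: D_nz Dk.
by move/(D_inj Dk)/eqP; apply/negP.
Qed.

Variables (s : I * bool -> I * bool) (Z : I * bool -> V -> Prop).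
Hypothesis Z_D : forall l v, Z l v -> D l v.
Hypothesis Z_act : forall l v, Z l v -> Z (s l) (act (weval m [:: linv l]) v).
(** Ping-pong is played in [H], while the conclusion concerns the same words evaluated in a second
    group [G]. The element [t l] records how [Z l] is reached from a base point, and [t_s] makes
    successive records compatible up to [C]. *)
Variables (G : groupType) (f : I -> G) (C : G -> Prop) (t : I * bool -> G).
Hypothesis C1 : C 1%g.
Hypothesis CM : forall g h, C g -> C h -> C (g * h)%g.
Hypothesis CV : forall g, C g -> C g^-1%g.
Hypothesis t_s : forall l, C ((t (s l))^-1 * (weval f [:: l])^-1 * t l)%g.

(* Z l is a point whose itinerary through the sets D is l, s l, s (s l), ...
   A reduced word carrying Z l to Z k can be shortened along the itinerary of
   Z l on the right or along the itinerary of Z k on the left: otherwise it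
   would send Z l into the set D indexed by its first letter. *)
Lemma itinerary_transporter w l k v : Z l v -> Z k (act (weval m w) v) ->
  C ((t k)^-1 * weval f w * t l)%g.
Proof.
have [u red_u wu] := weq_reduced w.
rewrite !(weval_weq _ wu) // => {w wu}.
have [n] := ubnP (size u); elim: n u red_u l k v => // n IHn.
case/lastP => [|w e] red_w l k v.
  rewrite {1}/weval big_nil act1 => _ /Z_D Dl /Z_D Dk.
  by rewrite (D_inj Dk Dl) /weval big_nil mulg1 mulVg.
rewrite ltnS size_rcons => lt_wn Zl Zk.
have [el|nel] := eqVneq e (linv l).
  move: Zk; rewrite -cats1 !weval_cat actM el => Zk.
  have red_w' : reduced w.
    by move: red_w; case: (w) => //= a w1; rewrite /reduced /= rcons_path => /andP[].
  have := CM (IHn w red_w' (s l) k _ lt_wn (Z_act Zl) Zk) (t_s l).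
  by rewrite weval_linv !mulgA mulgK.
case E: (rcons w e) => [|a u]; first by case: (w) E.
have Dw : D a (act (weval m (rcons w e)) v).
  rewrite E; apply: ping_pong; first by rewrite -E.
  - exact/D_nz/Z_D/Zl.
  - have := congr1 (last a) E; rewrite last_rcons /= => <- De.
    by case/eqP: nel; rewrite -(D_inj De (Z_D Zl)) linvK.
have ka := D_inj (Z_D Zk) Dw; subst a.
have := Z_act Zk; rewrite E [weval m (k :: u)]weval_cons -actM weval_linv mulKg => Zsk.
have red_u : reduced u by move: red_w; rewrite E => /path_sorted.
have lt_un : (size u < n)%N by move: (congr1 size E); rewrite size_rcons => -[<-].
have := CM (CV (t_s k)) (IHn u red_u l _ v lt_un Zl Zsk).
by rewrite !invgM !invgK [weval f (k :: u)]weval_cons !mulgA mulgK.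
Qed.

End PingPong.

(** * Ping-pong for an amalgam of [F1] and [F2] along [C] *)

Section AmalgamPingPong.
Variables (G : groupType) (F1 F2 C : G -> Prop).
Hypothesis F1_1 : F1 1%g.
Hypothesis F1_M : forall g h, F1 g -> F1 h -> F1 (g * h)%g.
Hypothesis F2_M : forall g h, F2 g -> F2 h -> F2 (g * h)%g.
Hypothesis C_F1 : forall g, C g -> F1 g.
Hypothesis C_F2 : forall g, C g -> F2 g.
Hypothesis gen : forall P : G -> Prop, P 1%g ->
  (forall g h, F1 g \/ F2 g -> P h -> P (g * h)%g) -> forall g, P g.

(** The final factor from [F1] may lie in [C], which makes the set stable under right multiplication
    by [F1]. *)
Inductive alternating : G -> Prop :=
| alt_last h g : F2 h -> ~ C h -> F1 g -> alternating (h * g)%g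
| alt_cons h g r : F2 h -> ~ C h -> F1 g -> ~ C g -> alternating r ->
    alternating (h * g * r)%g.

Lemma alternating_mulr r g : alternating r -> F1 g -> alternating (r * g)%g.
Proof.
move=> alt_r F1g; elim: r / alt_r => [h k F2h nCh F1k|h k r F2h nCh F1k nCk _ IHr].
  by rewrite -mulgA; apply: alt_last => //; apply: F1_M.
by rewrite -mulgA; apply: alt_cons.
Qed.

(** The factor [h] merges with the leading factor of [r]. If the product falls into [C], it is
    absorbed by the next factor, from [F1]. *)
Lemma alternating_mull h r : F2 h -> alternating r ->
  exists2 g, F1 g &
    (h * r = g)%g \/ exists2 r', alternating r' & (h * r = g * r')%g.
Proof.
move=> F2h [k g F2k nCk F1g|k g r' F2k nCk F1g nCg alt_r'].
  have F2hk := F2_M F2h F2k; have [Chk|nChk] := pselect (C (h * k)%g).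
    exists (h * k * g)%g; first by apply: F1_M => //; apply: C_F1.
    by left; rewrite mulgA.
  exists 1%g => //; right; exists (h * k * g)%g; last by rewrite mul1g mulgA.
  exact: alt_last.
have F2hk := F2_M F2h F2k; have [Chk|nChk] := pselect (C (h * k)%g).
  exists (h * k * g)%g; first by apply: F1_M => //; apply: C_F1.
  by right; exists r'; rewrite // !mulgA.
exists 1%g => //; right; exists (h * k * g * r')%g; last by rewrite mul1g !mulgA.
exact: alt_cons.
Qed.

Lemma amalgam_normal_form g :
  F1 g \/ exists g0 r, [/\ F1 g0, alternating r & g = (g0 * r)%g].
Proof.
elim/gen: g => [|g h [F1g|F2g]]; first by left.
  case=> [F1h|[g0 [r [F1g0 alt_r ->]]]]; first by left; apply: F1_M.
  by right; exists (g * g0)%g, r; rewrite mulgA; split=> //; apply: F1_M.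
have [Cg|nCg] := pselect (C g).
  have F1g := C_F1 Cg.
  case=> [F1h|[g0 [r [F1g0 alt_r ->]]]]; first by left; apply: F1_M.
  by right; exists (g * g0)%g, r; rewrite mulgA; split=> //; apply: F1_M.
case=> [F1h|[g0 [r [F1g0 alt_r ->]]]].
  by right; exists 1%g, (g * h)%g; rewrite mul1g; split=> //; apply: alt_last.
have [Cg0|nCg0] := pselect (C g0); last first.
  right; exists 1%g, (g * g0 * r)%g; rewrite mul1g mulgA; split=> //.
  exact: alt_cons.
rewrite mulgA; have [g1 F1g1 [->|[r' alt_r' ->]]] :=
  alternating_mull (F2_M F2g (C_F2 Cg0)) alt_r; first by left.
by right; exists g1, r'.
Qed.

Variables (V : Type) (act : G -> V -> V) (X1 X2 : V -> Prop).
Hypothesis actM : forall g h v, act (g * h)%g v = act g (act h v).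
Hypothesis X12 : forall v, X1 v -> ~ X2 v.
Hypothesis F1_act : forall g v, F1 g -> ~ C g -> X2 v -> X1 (act g v).
Hypothesis F2_act : forall g v, F2 g -> ~ C g -> X1 v -> X2 (act g v).
Hypothesis F1_base : forall g, F1 g -> exists2 v, X1 v & X1 (act g v).

(** [F1_base] supplies a starting point that survives the last factor, even one in [C]. The point
    then alternates between [X2] and [X1], and the leading factor from [F2] leaves it in [X2]. *)
Lemma alternating_act r : alternating r -> exists2 v, X1 v & X2 (act r v).
Proof.
elim=> {r} [h g F2h nCh F1g|h g r F2h nCh F1g nCg _ [v X1v X2rv]].
  have [v X1v X1gv] := F1_base F1g; exists v; rewrite // actM.
  exact: F2_act.
by exists v; rewrite // !actM; apply: F2_act => //; apply: F1_act.
Qed.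

(** If [g = g0 * r] acts trivially, so does its conjugate [r * g0]. This conjugate is alternating,
    hence moves some point of [X1] into [X2]. *)
Lemma amalgam_kernel g : (forall v, act g v = v) -> F1 g.
Proof.
move=> act_g; have [//|[g0 [r [F1g0 alt_r eg]]]] := amalgam_normal_form g.
have [v X1v] := alternating_act (alternating_mulr alt_r F1g0).
suff -> : act (r * g0)%g v = v by move/X12: X1v.
have -> : (r * g0 = g0^-1 * (g * g0))%g by rewrite eg -mulgA mulKg.
rewrite actM [act (g * g0)%g v]actM act_g -actM mulVg.
(* That [1] fixes [v] follows from [v = act g v] and [1 * g = g]. *)
by rewrite -{2}(act_g v) -{1}(act_g v) -actM mul1g.
Qed.

End AmalgamPingPong.

(** * The free group generated by A and B *)

Lemma det_mx22 (R : comPzRingType) (M : 'M[R]_2) :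
  \det M = M 0 0 * M 1 1 - M 0 1 * M 1 0.
Proof.
rewrite (expand_det_row _ 0) !big_ord_recl big_ord0 /cofactor !det_mx11 !mxE /=.
rewrite addr0 expr0 expr1 mul1r mulN1r mulrN.
by congr (M _ _ * M _ _ - M _ _ * M _ _); apply: val_inj.
Qed.

Section SpecialLinear2.
Variable K : fieldType.
Implicit Types g h : SL 2 K.

Lemma ord2P (i : 'I_2) : i = 0 \/ i = 1.
Proof. by case: i => [[|[]]] // i; [left|right]; apply: val_inj. Qed.

Lemma SL2P g h : g 0 0 = h 0 0 -> g 0 1 = h 0 1 -> g 1 0 = h 1 0 ->
  g 1 1 = h 1 1 -> g = h.
Proof.
move=> e00 e01 e10 e11; apply/val_inj/matrixP => i j.
by case: (ord2P i) (ord2P j) => -> [] ->.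
Qed.

Lemma SL2_mulE g h i j : (g * h)%g i j = g i 0 * h 0 j + g i 1 * h 1 j.
Proof.
rewrite /= mxE !big_ord_recl big_ord0 addr0.
by congr (g i _ * h _ j + g i _ * h _ j); apply: val_inj.
Qed.

Lemma SL2_oneE i j : (1%g : SL 2 K) i j = (i == j)%:R.
Proof. by rewrite /= mxE. Qed.

Lemma det_mx2 (a b c d : K) : \det (mx2 a b c d) = a * d - b * c.
Proof. by rewrite det_mx22 !mxE. Qed.

Lemma SL2_det g : g 0 0 * g 1 1 - g 0 1 * g 1 0 = 1.
Proof. by rewrite -(SL_det g) det_mx22. Qed.

Lemma SL2_invE g : [/\ (g^-1)%g 0 0 = g 1 1, (g^-1)%g 0 1 = - g 0 1,
  (g^-1)%g 1 0 = - g 1 0 & (g^-1)%g 1 1 = g 0 0].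
Proof.
have det_h : \det (mx2 (g 1 1) (- g 0 1) (- g 1 0) (g 0 0)) == 1.
  by rewrite det_mx2 mulrNN mulrC SL2_det.
have -> : (g^-1)%g = MkSL det_h; last by rewrite !mxE.
apply: mulg1_eq; apply: SL2P; rewrite SL2_mulE SL2_oneE !mxE /= -?(SL2_det g); ring.
Qed.

Definition SL2_act g (v : K * K) : K * K :=
  (g 0 0 * v.1 + g 0 1 * v.2, g 1 0 * v.1 + g 1 1 * v.2).

Lemma SL2_act1 v : SL2_act 1%g v = v.
Proof. by rewrite /SL2_act !SL2_oneE !mul1r !mul0r addr0 add0r -surjective_pairing. Qed.

Lemma SL2_actM g h v : SL2_act (g * h)%g v = SL2_act g (SL2_act h v).
Proof. by rewrite /SL2_act !SL2_mulE /=; congr (_, _); ring. Qed.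

End SpecialLinear2.

(** The pair of natural exponents encodes the integer power of [k] with exponent [j - i]. *)
Definition power_of (G : groupType) (k g : G) : Prop :=
  exists i j : nat, (g * k ^+ i = k ^+ j)%g.

Section PowerOf.
Variables (G : groupType) (k : G).

Lemma power_of1 : power_of k 1%g.
Proof. by exists 0, 0; rewrite mulg1. Qed.

Lemma power_of_id : power_of k k.
Proof. by exists 0, 1; rewrite mulg1. Qed.

Lemma power_ofM g h : power_of k g -> power_of k h -> power_of k (g * h)%g.
Proof.
move=> [i [j gi]] [i' [j' hi]]; exists (i' + i)%N, (j + j')%N.
rewrite expgnDr mulgA -[(g * h * _)%g]mulgA hi -mulgA -expgnDr addnC.
by rewrite expgnDr mulgA gi expgnDr.
Qed.

Lemma power_ofV g : power_of k g -> power_of k g^-1%g.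
Proof. by move=> [i [j gi]]; exists j, i; rewrite -gi mulKg. Qed.

End PowerOf.

Section Matrices.
Variables (K : fieldType) (x y : K).

Definition mxA : 'M[K]_2 :=
  mx2 ((1 - 2 * x ^+ 2 - 2 * x ^+ 3) / (x * (x - 1)))
      ((- 1 + 2 * x ^+ 2 + x ^+ 3 + x ^+ 4) / (x ^+ 3 * (1 - x)))
      1
      (1 / x ^+ 2).

Definition mxB : 'M[K]_2 :=
  mx2 ((x ^+ 2 - 1) / (x - 2 * x ^+ 3 - 2 * x ^+ 4))
      ((1 + 2 * x - x ^+ 2 - 3 * x ^+ 3 - 2 * x ^+ 4)
         / (x ^+ 2 * (2 * x ^+ 3 + 2 * x ^+ 2 - 1)))
      x
      (1 + x).

Definition mxD : 'M[K]_2 :=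
  mx2 ((1 - 2 * x ^+ 2 - 2 * x ^+ 3) / (x * (x - 1)))
      ((- 1 + 2 * x ^+ 2 + x ^+ 3 + x ^+ 4) / (y * x ^+ 3 * (1 - x)))
      y
      (1 / x ^+ 2).

Definition mxC : 'M[K]_2 :=
  mx2 ((x ^+ 2 - 1) / (x - 2 * x ^+ 3 - 2 * x ^+ 4))
      ((1 + 2 * x - x ^+ 2 - 3 * x ^+ 3 - 2 * x ^+ 4)
         / (y * x ^+ 2 * (2 * x ^+ 3 + 2 * x ^+ 2 - 1)))
      (y * x)
      (1 + x).

End Matrices.

(** * Ping-pong of [A] and [B] for a valuation with [x] large and [2] a unit *)

Section Schottky.
Variables (K : fieldType) (le : rel K) (leP : valuation_preorder le) (x : K).
Local Notation lt a b := (~~ le b a).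
Hypothesis lt1x : lt 1 x.
Hypothesis le12 : le 1 2.
Local Notation q := (2 * x ^+ 3 + 2 * x ^+ 2 - 1).

(** The common shape of the disc estimates: [b] is a leading term of size at least [m], while the
    lower terms [r] and the competitor [s] stay below [m]. *)
Lemma vlt_dominant s r b m : lt s m -> lt r m -> le m b -> lt s (r + b).
Proof.
move=> sm rm mb; apply: (vlt_le_trans leP sm).
by apply: (vle_trans leP mb); apply: vle_lead => //; apply: vlt_le_trans mb.
Qed.

Lemma vle_double w : le w (2 * w).
Proof. by rewrite -{1}[w]mul1r (vleM2r leP). Qed.

Lemma x_neq0 : x != 0. Proof. exact: vlt1_neq0 lt1x. Qed.

Lemma x_subr1_neq0 : x - 1 != 0.
Proof. by rewrite subr_eq0; apply: contraNneq lt1x => ->; apply: vle_refl leP _. Qed.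

Lemma subr1_x_neq0 : 1 - x != 0.
Proof. by rewrite -opprB oppr_eq0 x_subr1_neq0. Qed.

Lemma cubic_neq0 : q != 0.
Proof.
have lt0q : lt 0 q.
  (* The factors [1%:R], [x ^+ 0] and [1] put the lower terms in the shape required by
     [vlt_monomial]. *)
  have -> : q = (2%:R * x ^+ 2 * 1 - 1%:R * x ^+ 0 * 1) + 2 * (x ^+ 3 * 1) by ring.
  apply: (@vlt_dominant _ _ _ (x ^+ 3 * 1)); last exact: vle_double.
    by rewrite vlt0 // mulr1 expf_neq0 ?x_neq0.
  by rewrite vltD ?vleNr // vlt_monomial ?oner_eq0 ?(vle_refl leP).
by rewrite -(vlt0 leP).
Qed.

#[local] Hint Resolve x_neq0 x_subr1_neq0 subr1_x_neq0 cubic_neq0 : core.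

Lemma quartic_neq0 : x - 2 * x ^+ 3 - 2 * x ^+ 4 != 0.
Proof.
have -> : x - 2 * x ^+ 3 - 2 * x ^+ 4 = - (x * q) by ring.
by rewrite oppr_eq0 mulf_neq0 ?x_neq0 ?cubic_neq0.
Qed.

Lemma det_mxA : \det (mxA x) = 1.
Proof. by rewrite det_mx2; field; rewrite x_neq0 x_subr1_neq0 subr1_x_neq0. Qed.

Lemma det_mxB : \det (mxB x) = 1.
Proof. by rewrite det_mx2; field; rewrite x_neq0 cubic_neq0 quartic_neq0. Qed.

Lemma det_mxD y : y != 0 -> \det (mxD x y) = 1.
Proof. by move=> y0; rewrite det_mx2; field; rewrite y0 x_neq0 x_subr1_neq0 subr1_x_neq0. Qed.

Lemma det_mxC y : y != 0 -> \det (mxC x y) = 1.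
Proof. by move=> y0; rewrite det_mx2; field; rewrite y0 x_neq0 cubic_neq0 quartic_neq0. Qed.

Ltac monomials :=
  repeat (apply: (vltD leP)); rewrite ?(vleNr leP);
  apply: (vlt_monomial leP) => //.

Variables A B : SL 2 K.
Hypothesis AE : slval A = mxA x.
Hypothesis BE : slval B = mxB x.

(* The four discs of the projective line, in the homogeneous coordinates (u : v).
   Up to terms of smaller degree, the attracting fixed points of A, A^-1, B and
   B^-1 are -2x, -1/(2x), -1/x^2 and -1. *)
Definition disc (l : bool * bool) (v : K * K) : bool :=
  match l with
  | (false, false) => lt v.2 v.1
  | (false, true) => lt (2 * x * v.1 + v.2) v.2
  | (true, false) => lt (x * v.1) v.2
  | (true, true) => lt (v.1 + v.2) v.2
  end.

(** Off the disc of [A^-1], the form [t = 2 * x * u + v] bounds both [v] and [x * u]. Once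
    denominators are cleared, the first coordinate of the image has leading term [- x ^+ 4 * t], and
    all other terms have smaller exponents. *)
Lemma disc_A u v : (u, v) != (0, 0) -> ~~ disc (false, true) (u, v) ->
  disc (false, false) (SL2_act A (u, v)).
Proof.
rewrite /= negbK AE !mxE /=; set t := 2 * x * u + v => uv0 le_vt.
have le_xut : le (x * u) t.
  apply: (vle_trans leP (vle_double _)).
  have -> : 2 * (x * u) = t - v by rewrite /t; ring.
  by rewrite (vleD leP) ?vleN ?(vle_refl leP).
have t0 : t != 0.
  apply: contraNneq uv0 => t0; move: le_vt le_xut; rewrite t0 => /(vle_eq0 leP) ->.
  by move/(vle_eq0 leP)/eqP; rewrite mulf_eq0 (negPf x_neq0) => /eqP ->.
rewrite -(vleM2rE leP (c := x ^+ 3 * (x - 1))) ?mulf_neq0 ?expf_neq0 //.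
set a := _ * _; set b := _ * _.
have -> : a = (1%:R * x ^+ 1 * (x * u) - 2%:R * x ^+ 3 * (x * u)
               - 1%:R * x ^+ 3 * v - 2%:R * x ^+ 2 * v + 1%:R * x ^+ 0 * v)
              - x ^+ 4 * t.
  by rewrite /a /t; field; rewrite ?x_neq0 ?x_subr1_neq0 ?subr1_x_neq0.
have -> : b = 1%:R * x ^+ 3 * (x * u) - 1%:R * x ^+ 2 * (x * u)
              + 1%:R * x ^+ 2 * v - 1%:R * x ^+ 1 * v.
  by rewrite /b; field; rewrite ?x_neq0 ?x_subr1_neq0.
apply: (@vlt_dominant _ _ _ (x ^+ 4 * t)).
- monomials.
- monomials.
- by rewrite vleNr // (vle_refl leP).
Qed.

(** Off the disc of [A], [v] bounds [u]. The second coordinate of the image has leading term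
    [- 2 * x ^+ 5 * v], which cancels in the form defining the disc of [A^-1]. *)
Lemma disc_AV u v : (u, v) != (0, 0) -> ~~ disc (false, false) (u, v) ->
  disc (false, true) (SL2_act A^-1%g (u, v)).
Proof.
rewrite /SL2_act; have [-> -> -> ->] := SL2_invE A.
rewrite /= negbK AE !mxE /= => uv0 le_uv.
have v0 : v != 0.
  by apply: contraNneq uv0 => v0; move: le_uv; rewrite v0 => /(vle_eq0 leP) ->.
have le_vv := vle_refl leP v.
rewrite -(vleM2rE leP (c := x ^+ 3 * (x - 1))) ?mulf_neq0 ?expf_neq0 //.
set b := _ * _; set a := _ * _.
have -> : a = (3%:R * x ^+ 3 * u - 2%:R * x ^+ 2 * u - 1%:R * x ^+ 4 * u)
              + 4%:R * x ^+ 3 * v + 1%:R * x ^+ 2 * v - 2%:R * x ^+ 1 * v.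
  by rewrite /a; field; rewrite ?x_neq0 ?x_subr1_neq0 ?subr1_x_neq0.
have -> : b = (1%:R * x ^+ 3 * u - 1%:R * x ^+ 4 * u + 1%:R * x ^+ 2 * v
               - 2%:R * x ^+ 4 * v) - 2 * (x ^+ 5 * v).
  by rewrite /b; field; rewrite ?x_neq0 ?x_subr1_neq0.
apply: (@vlt_dominant _ _ _ (x ^+ 5 * v)); try by monomials.
by rewrite vleNr // vle_double.
Qed.

(** Off the disc of [B^-1], [s = u + v] bounds [u] and [v]; the leading term is [2 * x ^+ 6 * s], in
    the second coordinate. *)
Lemma disc_B u v : (u, v) != (0, 0) -> ~~ disc (true, true) (u, v) ->
  disc (true, false) (SL2_act B (u, v)).
Proof.
rewrite /= negbK BE !mxE /=; set s := u + v => uv0 le_vs.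
have le_us : le u s.
  have -> : u = s - v by rewrite /s addrK.
  by rewrite (vleD leP) ?vleN ?(vle_refl leP).
have le_ss := vle_refl leP s.
have s0 : s != 0.
  apply: contraNneq uv0 => s0; move: le_vs le_us; rewrite s0 => /(vle_eq0 leP) ->.
  by move/(vle_eq0 leP) ->.
rewrite -(vleM2rE leP (c := x ^+ 2 * q)) ?mulf_neq0 ?expf_neq0 //.
set b := _ * _; set a := _ * _.
have -> : a = 1%:R * x ^+ 2 * u - 1%:R * x ^+ 4 * u
   + 1%:R * x ^+ 1 * v + 2%:R * x ^+ 2 * v - 1%:R * x ^+ 3 * v - 3%:R * x ^+ 4 * v
   - 2%:R * x ^+ 5 * v.
  by rewrite /a; field; rewrite cubic_neq0 quartic_neq0 x_neq0.
have -> : b = (2%:R * x ^+ 5 * s - 1%:R * x ^+ 3 * s + 2%:R * x ^+ 5 * v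
               + 2%:R * x ^+ 4 * v - 1%:R * x ^+ 2 * v) + 2 * (x ^+ 6 * s).
  by rewrite /b /s; ring.
by apply: (@vlt_dominant _ _ _ (x ^+ 6 * s)); rewrite ?vle_double //; monomials.
Qed.

(** Off the disc of [B], [w = x * u] bounds [v]. The leading term [- 2 * x ^+ 5 * w] of the second
    coordinate cancels in the sum of the coordinates. *)
Lemma disc_BV u v : (u, v) != (0, 0) -> ~~ disc (true, false) (u, v) ->
  disc (true, true) (SL2_act B^-1%g (u, v)).
Proof.
rewrite /SL2_act; have [-> -> -> ->] := SL2_invE B.
rewrite /= negbK BE !mxE /= => uv0; set w := x * u => le_vw.
have w0 : w != 0.
  apply: contraNneq uv0 => w0; move: le_vw; rewrite w0 => /(vle_eq0 leP) ->.
  by move/eqP: w0; rewrite mulf_eq0 (negPf x_neq0) => /eqP ->.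
have le_ww := vle_refl leP w.
rewrite -(vleM2rE leP (c := x ^+ 2 * q)) ?mulf_neq0 ?expf_neq0 //.
set b := _ * _; set a := _ * _.
have -> : a = 2%:R * x ^+ 4 * w + 2%:R * x ^+ 3 * w - 1%:R * x ^+ 1 * w
   - 1%:R * x ^+ 0 * v - 1%:R * x ^+ 1 * v + 1%:R * x ^+ 2 * v + 2%:R * x ^+ 3 * v
   + 2%:R * x ^+ 4 * v.
  by rewrite /a /w; field; rewrite cubic_neq0 quartic_neq0 x_neq0.
have -> : b = (1%:R * x ^+ 2 * w - 2%:R * x ^+ 4 * w - 1%:R * x ^+ 3 * v
               + 1%:R * x ^+ 1 * v) - 2 * (x ^+ 5 * w).
  by rewrite /b /w; field; rewrite quartic_neq0.
by apply: (@vlt_dominant _ _ _ (x ^+ 5 * w)); rewrite ?vleNr ?vle_double //; monomials.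
Qed.

Lemma disc_neq0 l v : disc l v -> v != (0, 0).
Proof.
case: v => u v; case: l => [[] []] /=; apply: contraNneq => -[-> ->];
  by rewrite ?(mulr0, addr0) (vle_refl leP).
Qed.

(* The disc containing (u, v) is determined by the position of v relative to
   u and x * u in the preorder. *)
Lemma disc_position l u v : disc l (u, v) ->
  (le u v, lt u v, lt (x * u) v) =
  match l with
  | (false, false) => (false, false, false)
  | (false, true) => (true, true, false)
  | (true, false) => (true, true, true)
  | (true, true) => (true, false, false)
  end.
Proof.
have le_xu : le u (x * u) by rewrite -{1}[u]mul1r (vleM2r leP) // vltW.
have xuv_uv : lt (x * u) v -> le u v /\ lt u v.
  by move/(vle_lt_trans leP le_xu) => uv; rewrite vltW.
case: l => [[] []] /= uv.
- have le_uv : le u v.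
    have -> : u = (u + v) - v by ring.
    by rewrite (vleD leP) ?vleN ?(vle_refl leP) // vltW.
  have not_uv : lt u v = false.
    apply: contraTF (vle_refl leP v) => lt_uv; rewrite -{2}[v](addKr u) addrC.
    by rewrite (vltD leP) ?vleNr.
  rewrite le_uv not_uv; congr (_, _, _); apply: contraFF not_uv.
  by case/xuv_uv.
- by rewrite uv; case: (xuv_uv uv) => -> ->.
- have le_xuv : le (x * u) v.
    apply: (vle_trans leP (vle_double _)).
    have -> : 2 * (x * u) = (2 * x * u + v) - v by ring.
    by rewrite (vleD leP) ?vleN ?(vle_refl leP) // vltW.
  have v0 : v != 0 by rewrite -(vlt0 leP) (vle_lt_trans leP _ uv) ?vle0.
  have lt_uv : lt u v.
    have [->|u0] := eqVneq u 0; first by rewrite vlt0.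
    by apply: (vlt_le_trans leP _ le_xuv); rewrite -{2}[u]mul1r vleM2rE.
  rewrite lt_uv vltW //; congr (_, _, _).
  (* If [x * u] were strictly below [v], then [v] would be a difference of two terms strictly below
     [v]. *)
  apply: contraTF (vle_refl leP v) => lt_xuv.
  have -> : le v v = le v ((2 * x * u + v) - 2 * (x * u)) by congr le; ring.
  rewrite (vltD leP) ?vleNr // (vle_lt_trans leP _ lt_xuv) //.
  by rewrite -[X in le _ X]mul1r (vleM2r leP) ?(vle_nat leP 2).
- have not_uv : lt u v = false by apply/negbF; apply: vltW.
  rewrite (negPf uv) not_uv; congr (_, _, _).
  by apply: contraFF not_uv => /xuv_uv[].
Qed.

Lemma disc_inj l k v : disc l v -> disc k v -> l = k.
Proof.
case: v => u v /disc_position el /disc_position; rewrite el.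
by case: l k {el} => [[] []] [[] []].
Qed.

Definition multiplier := x * (1 - 2 * x ^+ 2 - 2 * x ^+ 3) / (x - 1).

Lemma multiplier_gt1 : lt 1 multiplier.
Proof.
rewrite -(vleM2rE leP (c := x - 1)) // mul1r divfK //.
have -> : x * (1 - 2 * x ^+ 2 - 2 * x ^+ 3) =
    (1%:R * x ^+ 1 * 1 - 2%:R * x ^+ 3 * 1) - 2 * (x ^+ 4 * 1) by ring.
have -> : x - 1 = 1%:R * x ^+ 1 * 1 - 1%:R * x ^+ 0 * 1 by ring.
have le11 := vle_refl leP 1.
apply: (@vlt_dominant _ _ _ (x ^+ 4 * 1)); last by rewrite vleNr // vle_double.
  by monomials; rewrite oner_eq0.
by monomials; rewrite oner_eq0.
Qed.

Lemma commutator_diag : let k := (A * B * A^-1 * B^-1)%g in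
  [/\ k 0 0 = multiplier, k 0 1 = 0 & k 1 0 = 0].
Proof.
have l0 : multiplier != 0.
  by rewrite -(vlt0 leP) (vle_lt_trans leP _ multiplier_gt1) ?vle0.
have det_k : \det (mx2 multiplier 0 0 multiplier^-1) == 1.
  by rewrite det_mx2 divff // mulr0 subr0.
suff -> : (A * B * A^-1 * B^-1)%g = MkSL det_k by rewrite /= !mxE.
have p0 : 1 - 2 * x ^+ 2 - 2 * x ^+ 3 != 0.
  by apply: contraNneq l0; rewrite /multiplier => ->; rewrite mulr0 mul0r.
(* Without inverse matrices, the identity is four equations between rational functions of [x]. *)
suff e : (A * B = MkSL det_k * B * A)%g by rewrite e !mulgK.
by apply: SL2P; rewrite !SL2_mulE AE BE !mxE /= /multiplier; field;
  rewrite ?x_neq0 ?x_subr1_neq0 ?subr1_x_neq0 ?cubic_neq0 ?quartic_neq0 ?p0.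
Qed.

Lemma commutator_exp_inj : injective (fun n => (A * B * A^-1 * B^-1) ^+ n)%g.
Proof.
have [k00 k01 k10] := commutator_diag; set k := (_ / B)%g in k00 k01 k10.
have expk n : (k ^+ n)%g 0 0 = multiplier ^+ n.
  elim: n => [|n IHn]; first by rewrite SL2_oneE.
  by rewrite expgS SL2_mulE IHn k00 k01 mul0r addr0 exprS.
move=> i j /(congr1 (fun M : SL 2 K => M 0 0)); rewrite !expk.
exact: (vexp_inj leP multiplier_gt1).
Qed.

Definition generator (b : bool) : SL 2 K := if b then B else A.

(** * Itineraries of the two fixed points of the commutator *)

Section DiagonalFixedPoint.
Variable g : bool.

(* The point at infinity (1 : 0) for g = false and the point (0 : 1) for
   g = true. *)
Definition axis_point (v : K * K) : bool :=
  if g then (v.1 == 0) && (v.2 != 0) else (v.1 != 0) && (v.2 == 0).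

(** The commutator for [g = false] and its inverse for [g = true]: one period of the itinerary of
    the axis point. *)
Definition cyclic_word : word bool :=
  [:: (g, false); (~~ g, false); (g, true); (~~ g, true)].

(** The cyclic successor in [cyclic_word]: the generators alternate, and the sign flips after each
    letter other than [g]. *)
Definition next_letter (l : bool * bool) := (~~ l.1, l.2 (+) (l.1 != g)).

(* The first letter of cyclic_word is given the empty tail instead of the whole
   word: both agree modulo the powers of the commutator. *)
Definition axis_tail (l : bool * bool) : word bool :=
  if l == (g, false) then [::] else drop (index l cyclic_word) cyclic_word.

Lemma axis_tail_next l :
  axis_tail l = l :: axis_tail (next_letter l) \/
  axis_tail l = [::] /\ cyclic_word = l :: axis_tail (next_letter l).
Proof.
rewrite /axis_tail /next_letter /cyclic_word.
by case: l => [[] []]; case: (g) => /=; by [left | right].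
Qed.

Definition orbit_point l (v : K * K) : Prop :=
  exists2 v0, axis_point v0 & v = SL2_act (weval generator (axis_tail l)) v0.

Lemma axis_point_disc v : axis_point v -> disc (g, false) v.
Proof.
rewrite /axis_point; case: v g => u v [] /= /andP[].
  by move/eqP->; rewrite mulr0 vlt0.
by move=> u0 /eqP->; rewrite vlt0.
Qed.

Lemma generator_disc l v : v != (0, 0) -> ~ disc (linv l) v ->
  disc l (SL2_act (weval generator [:: l]) v).
Proof.
rewrite /weval big_seq1; case: v l => u v [[] []] v0 /negP; rewrite /linv /=.
- exact: disc_BV.
- exact: disc_B.
- exact: disc_AV.
- exact: disc_A.
Qed.

(** A nonempty tail starts with [l] and ends with the inverse of the generator [~~ g]. The axis
    point lies in the disc of [g], hence outside the one that ping-pong must avoid. *)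
Lemma orbit_point_disc l v : orbit_point l v -> disc l v.
Proof.
case=> v0 v0P ->; have v0D := axis_point_disc v0P.
have [->|[w [-> red_w last_w]]] : l = (g, false) \/ exists w,
    [/\ axis_tail l = l :: w, reduced (l :: w) & last l w = (~~ g, true)].
- rewrite /axis_tail /cyclic_word.
  case: l => [[] []]; case: (g) => /=; try by [left];
    right; eexists; split; reflexivity.
- by rewrite /axis_tail eqxx /weval big_nil SL2_act1.
apply: (@ping_pong _ _ _ _ (@SL2_actM _) _ (fun v => v != (0, 0))
  (fun l v => disc l v)) => //.
- exact: disc_neq0.
- exact: disc_inj.
- exact: generator_disc.
- exact: disc_neq0 v0D.
- by rewrite last_w => /(disc_inj v0D); case: (g).
Qed.

Lemma axis_point_diag (h : SL 2 K) v : h 0 1 = 0 -> h 1 0 = 0 ->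
  axis_point v -> axis_point (SL2_act h v).
Proof.
move=> h01 h10; have := SL2_det h; rewrite h01 h10 mul0r subr0 => det_h.
have : h 0 0 * h 1 1 != 0 by rewrite det_h oner_eq0.
rewrite mulf_eq0 negb_or => /andP[h00 h11].
rewrite /axis_point /SL2_act /= h01 h10 !mul0r addr0 add0r.
by rewrite !mulf_eq0 (negPf h00) (negPf h11).
Qed.

Lemma weval_cyclic_word (G : groupType) (f : bool -> G) :
  weval f cyclic_word =
    (if g then (f false * f true * (f false)^-1 * (f true)^-1)^-1
     else f false * f true * (f false)^-1 * (f true)^-1)%g.
Proof.
rewrite /weval !big_cons big_nil mulg1.
by case: (g); rewrite /= ?invgM ?invgK !mulgA.
Qed.

Lemma cyclic_word_diag : let k := weval generator cyclic_word in
  k 0 1 = 0 /\ k 1 0 = 0.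
Proof.
rewrite weval_cyclic_word /generator; have [_] := commutator_diag.
set k := (A * B * A^-1 * B^-1)%g => k01 k10.
have [_ V01 V10 _] := SL2_invE k.
by case: (g); rewrite ?V01 ?V10 ?k01 ?k10 ?oppr0.
Qed.

Lemma orbit_point_next l v : orbit_point l v ->
  orbit_point (next_letter l) (SL2_act (weval generator [:: linv l]) v).
Proof.
case=> v0 v0P ->; rewrite weval_linv.
have [k01 k10] := cyclic_word_diag; set k := weval generator cyclic_word in k01 k10.
have kV : axis_point (SL2_act k^-1%g v0).
  have [_ V01 V10 _] := SL2_invE k.
  by rewrite axis_point_diag // ?V01 ?V10 ?k01 ?k10 oppr0.
have [->|[-> ek]] := axis_tail_next l.
  by exists v0; rewrite // -SL2_actM [weval _ (l :: axis_tail _)]weval_cons mulKg.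
(* At the empty tail the itinerary wraps around: the next tail is the period without its first
   letter, so the axis point is moved back by one period. *)
exists (SL2_act k^-1%g v0) => //.
rewrite -!SL2_actM /k ek [weval _ (l :: axis_tail _)]weval_cons invgM mulVKg.
by rewrite [weval _ [::]]big_nil mulg1.
Qed.

End DiagonalFixedPoint.

(** A triangular matrix keeps one axis point on its axis, so the word transports the index
    [(g, false)] to itself. There the tail is empty, and [itinerary_transporter] makes the word
    itself a power of the commutator, in any group [G]. *)
Lemma weval_triangular (G : groupType) (f : bool -> G) w :
  (weval generator w) 1 0 = 0 \/ (weval generator w) 0 1 = 0 ->
  power_of (f false * f true * (f false)^-1 * (f true)^-1)%g (weval f w).
Proof.
set M := weval generator w; set k := (_ / f true)%g => M_triangular.
have det_M := SL2_det M.
have [g [v [vP MvP]]] : exists g v, axis_point g v /\ axis_point g (SL2_act M v).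
  have diag_neq0 : M 0 1 * M 1 0 = 0 -> (M 0 0 != 0) && (M 1 1 != 0).
    by move=> e; rewrite e subr0 in det_M; rewrite -negb_or -mulf_eq0 det_M oner_eq0.
  case: M_triangular => M0; have := diag_neq0; rewrite M0 ?(mulr0, mul0r);
    case/(_ erefl)/andP => M00 M11.
    exists false, (1, 0); rewrite /axis_point /SL2_act /= M0.
    by rewrite !mulr0 !mul0r !addr0 mulr1 oner_eq0 eqxx M00.
  exists true, (0, 1); rewrite /axis_point /SL2_act /= M0.
  by rewrite !mulr0 !mul0r !add0r mulr1 oner_eq0 eqxx M11.
have pw : power_of k (weval f (cyclic_word g)).
  rewrite weval_cyclic_word; case: (g); last exact: power_of_id.
  exact/power_ofV/power_of_id.
have ZP u : axis_point g u -> orbit_point g (g, false) u.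
  by exists u; rewrite // /axis_tail eqxx /weval big_nil SL2_act1.
pose t l := weval f (axis_tail g l).
(* This element is trivial except at the wrap-around, where it is the inverse of a full period. *)
have t_next l : power_of k ((t (next_letter g l))^-1 * (weval f [:: l])^-1 * t l)%g.
  rewrite /t; have [->|[-> ek]] := axis_tail_next g l.
    by rewrite [weval f (l :: axis_tail _ _)]weval_cons -invgM mulVg; apply: power_of1.
  by rewrite -invgM -weval_cons -ek [weval f [::]]big_nil mulg1; apply: power_ofV.
have := @itinerary_transporter _ _ _ (@SL2_act K) (@SL2_act1 K) (@SL2_actM K)
  generator (fun v => v != (0, 0)) (fun l v => disc l v) (@disc_neq0) (@disc_inj)
  (@generator_disc) (next_letter g) (orbit_point g) (@orbit_point_disc g)
  (@orbit_point_next g) G f (power_of k) t (power_of1 k) (@power_ofM _ k)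
  (@power_ofV _ k) t_next w _ _ _ (ZP _ vP) (ZP _ MvP).
have -> : t (g, false) = 1%g by rewrite /t /axis_tail eqxx [weval f [::]]big_nil.
by rewrite invg1 mul1g mulg1.
Qed.

End Schottky.

(** * The amalgam of two free groups *)

Lemma weval_morph (I : choiceType) (G H : groupType) (phi : UMagmaMorphism.type G H)
  (f : I -> G) w : phi (weval f w) = weval (phi \o f) w.
Proof.
by rewrite /weval gmulf_prod; apply: eq_bigr => -[i []] _ //=; rewrite gmulfV.
Qed.

Lemma weval_commutator (I : choiceType) (G : groupType) (f : I -> G) i j :
  weval f (wcomm (wgen i) (wgen j)) = (f i * f j * (f i)^-1 * (f j)^-1)%g.
Proof. by rewrite /wcomm !(weval_cat, weval_inv, weval_gen) !mulgA. Qed.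

(* N = T M T^-1 for T = diag(1, y). *)
Definition y_conjugate (K : fieldType) (y : K) (M N : SL 2 K) : Prop :=
  [/\ N 0 0 = M 0 0, N 0 1 = M 0 1 / y, N 1 0 = y * M 1 0 & N 1 1 = M 1 1].

Section SurfaceGroupRepresentation.
Variables (K : fieldType) (lex ley : rel K).
Hypothesis lexP : valuation_preorder lex.
Hypothesis leyP : valuation_preorder ley.
Local Notation ltx a b := (~~ lex b a).
Local Notation lty a b := (~~ ley b a).
(** [S] stands for the field of constants k(x), on which the valuation [ley] is trivial by
    [S_unit]. *)
Variables (S : divringClosed K) (x y : K).
Hypothesis Sx : x \in S.
Hypothesis S_unit : forall c, c \in S -> c != 0 -> ley c 1 && ley 1 c.
Hypothesis ltx1x : ltx 1 x.
Hypothesis lex12 : lex 1 2.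
Hypothesis lty1y : lty 1 y.

Variables A B C D : SL 2 K.
Hypothesis AE : slval A = mxA x.
Hypothesis BE : slval B = mxB x.

Hypothesis AD : y_conjugate y A D.
Hypothesis BC : y_conjugate y B C.

Local Notation gAB := (generator A B).
Local Notation gDC := (generator D C).

Let y_neq0 : y != 0. Proof. exact: vlt1_neq0 lty1y. Qed.

Lemma y_conjugateM M M' N N' : y_conjugate y M N -> y_conjugate y M' N' ->
  y_conjugate y (M * M')%g (N * N')%g.
Proof.
move=> [e00 e01 e10 e11] [f00 f01 f10 f11].
by split; rewrite !SL2_mulE ?e00 ?e01 ?e10 ?e11 ?f00 ?f01 ?f10 ?f11; field.
Qed.

Lemma y_conjugateV M N : y_conjugate y M N -> y_conjugate y M^-1%g N^-1%g.
Proof.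
move=> [e00 e01 e10 e11]; rewrite /y_conjugate.
have [-> -> -> ->] := SL2_invE M; have [-> -> -> ->] := SL2_invE N.
by rewrite e00 e01 e10 e11 mulNr mulrN.
Qed.

Lemma y_conjugate_weval w : y_conjugate y (weval gAB w) (weval gDC w).
Proof.
elim: w => [|[b s] w IHw].
  by rewrite /weval !big_nil /y_conjugate !SL2_oneE /= mul0r mulr0.
rewrite [weval gAB _]weval_cons [weval gDC _]weval_cons.
apply: y_conjugateM => //; rewrite /weval !big_seq1 /=.
by case: s b => [] []; rewrite /=; try apply: y_conjugateV.
Qed.

Lemma commutator_eq : (A * B * A^-1 * B^-1 = D * C * D^-1 * C^-1)%g.
Proof.
have [_ k01 k10] := commutator_diag lexP ltx1x lex12 AE BE.
have [e00 e01 e10 e11] :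
    y_conjugate y (A * B * A^-1 * B^-1)%g (D * C * D^-1 * C^-1)%g.
  by do !apply: y_conjugateM => //; apply: y_conjugateV.
by apply: SL2P; rewrite ?e00 ?e01 ?e10 ?e11 ?k01 ?k10 ?mul0r ?mulr0.
Qed.

Lemma weval_const w i j : weval gAB w i j \in S.
Proof.
have cA i' j' : A i' j' \in S.
  rewrite AE !mxE; case: (ord2P i') (ord2P j') => -> [] -> /=;
  by rewrite ?(rpred1, rpredM, rpredV, rpredD, rpredB, rpredN, rpredX, rpred_nat).
have cB i' j' : B i' j' \in S.
  rewrite BE !mxE; case: (ord2P i') (ord2P j') => -> [] -> /=;
  by rewrite ?(rpred1, rpredM, rpredV, rpredD, rpredB, rpredN, rpredX, rpred_nat).
have cV (M : SL 2 K) : (forall i' j', M i' j' \in S) ->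
    forall i' j', (M^-1)%g i' j' \in S.
  move=> cM i' j'; have [e00 e01 e10 e11] := SL2_invE M.
  by case: (ord2P i') (ord2P j') => -> [] ->; rewrite ?e00 ?e01 ?e10 ?e11 ?rpredN.
elim: w i j => [|[b s] w IHw] i j; first by rewrite /weval big_nil SL2_oneE rpred_nat.
rewrite weval_cons SL2_mulE /weval !big_seq1 /=.
by case: s b => [] []; rewrite rpredD ?rpredM ?cV.
Qed.

Section Injectivity.
Variable phi : UMagmaMorphism.type S2 (SL 2 K).
Hypothesis phi_a : phi S2a = A.
Hypothesis phi_b : phi S2b = B.
Hypothesis phi_c : phi S2c = C.
Hypothesis phi_d : phi S2d = D.

Definition gen_ab (b : bool) : S2 := if b then S2b else S2a.
Definition gen_dc (b : bool) : S2 := if b then S2c else S2d.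
Local Notation kappa := (S2a * S2b * S2a^-1 * S2b^-1)%g.

Definition in_ab (g : S2) : Prop := exists w, g = weval gen_ab w.
Definition in_dc (g : S2) : Prop := exists w, g = weval gen_dc w.

Lemma phi_ab w : phi (weval gen_ab w) = weval gAB w.
Proof. by rewrite weval_morph; congr weval; apply/funext => -[]. Qed.

Lemma phi_dc w : phi (weval gen_dc w) = weval gDC w.
Proof. by rewrite weval_morph; congr weval; apply/funext => -[]. Qed.

Lemma kappa_dc : kappa = (S2d * S2c * S2d^-1 * S2c^-1)%g.
Proof.
by apply: invg_inj; rewrite (mulg1_eq S2_relation) !invgM !invgK !mulgA.
Qed.

(** This puts the amalgamated subgroup inside both factors. *)
Lemma range_weval_power (f : bool -> S2) g :
  power_of (f false * f true * (f false)^-1 * (f true)^-1)%g g ->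
  exists w, g = weval f w.
Proof.
set k := (_ / f true)%g => -[i [j gk]].
have kE : k = weval f (wcomm (wgen false) (wgen true)) by rewrite weval_commutator.
have expk n : exists w, (k ^+ n)%g = weval f w.
  elim: n => [|n [w IHn]]; first by exists [::]; rewrite /weval big_nil.
  by rewrite expgS IHn kE -weval_cat; eexists.
have [u ui] := expk i; have [v vj] := expk j.
exists (v ++ winv u); rewrite weval_cat weval_inv -ui -vj -gk mulgK //.
Qed.

Lemma S2_gen (P : S2 -> Prop) : P 1%g ->
  (forall g h, in_ab g \/ in_dc g -> P h -> P (g * h)%g) -> forall g, P g.
Proof.
move=> P1 PM; elim/pcls_ind; elim=> [|[i b] w IHw]; first exact: P1.
rewrite -cat1s pclsM; apply: PM IHw.
have pclsE : pcls S2_rels [:: (i, b)] =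
    (if b then (pgen S2_rels i)^-1 else pgen S2_rels i)%g.
  by case: b => //; rewrite /pgen -pclsV.
rewrite pclsE; case: i {pclsE} => [[|[|[|[|//]]]] lt_i].
- left; exists [:: (false, b)]; rewrite /weval big_seq1 /= /S2a.
  by rewrite (_ : Ordinal lt_i = gen_a); last exact: val_inj.
- left; exists [:: (true, b)]; rewrite /weval big_seq1 /= /S2b.
  by rewrite (_ : Ordinal lt_i = gen_b); last exact: val_inj.
- right; exists [:: (true, b)]; rewrite /weval big_seq1 /= /S2c.
  by rewrite (_ : Ordinal lt_i = gen_c); last exact: val_inj.
- right; exists [:: (false, b)]; rewrite /weval big_seq1 /= /S2d.
  by rewrite (_ : Ordinal lt_i = gen_d); last exact: val_inj.
Qed.

Lemma const_le c : c \in S -> ley c 1.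
Proof.
move=> Sc; have [->|c0] := eqVneq c 0; first exact: vle0.
by case/andP: (S_unit Sc c0).
Qed.

Lemma const_mul_le c a : c \in S -> ley (c * a) a.
Proof. by move=> Sc; rewrite -{2}[a]mul1r (vleM2r leyP) // const_le. Qed.

Lemma le_const_mul c a : c \in S -> c != 0 -> ley a (c * a).
Proof.
by move=> Sc c0; case/andP: (S_unit Sc c0) => _ /(vleM2r leyP a); rewrite mul1r.
Qed.

Definition y_small (v : K * K) : bool := (v.1 != 0) && ley v.2 v.1.
Definition y_large (v : K * K) : bool := lty v.1 v.2.

(** Outside the powers of [kappa] the matrix is not triangular, so its (0,1) entry is a nonzero
    constant. The first coordinate of the image then has the size of [v], and the second is no
    larger. *)
Lemma in_ab_act g v : in_ab g -> ~ power_of kappa g -> y_large v ->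
  y_small (SL2_act (phi g) v).
Proof.
case=> w -> nC; rewrite phi_ab; set M := weval gAB w.
have M01 : M 0 1 != 0.
  apply: contra_notN nC => /eqP M01.
  exact: (weval_triangular lexP ltx1x lex12 AE BE gen_ab (or_intror M01)).
have SM i j : M i j \in S by apply: weval_const.
rewrite /y_large /y_small /SL2_act /=; case: v => u v /= lt_uv.
have v0 : v != 0 by rewrite -(vlt0 leyP) (vle_lt_trans leyP _ lt_uv) ?vle0.
have le_v : ley v (M 0 0 * u + M 0 1 * v).
  apply: (vle_trans leyP (le_const_mul v (SM 0 1) M01)).
  apply: vle_lead => //; apply: (vlt_le_trans leyP _ (le_const_mul v (SM 0 1) M01)).
  exact: (vle_lt_trans leyP (const_mul_le u (SM 0 0))).
apply/andP; split.
  by apply: contraNneq v0 => e; move: le_v; rewrite e => /(vle_eq0 leyP) ->.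
apply: (vle_trans leyP _ le_v); apply: (vleD leyP); last exact: const_mul_le.
by apply: (vle_trans leyP (const_mul_le u (SM 1 0))); apply: vltW.
Qed.

(** Conjugation multiplies the nonzero (1,0) entry by [y], so the second coordinate of the image has
    the size of [y * u]. The first stays at most that of [u]. *)
Lemma in_dc_act g v : in_dc g -> ~ power_of kappa g -> y_small v ->
  y_large (SL2_act (phi g) v).
Proof.
case=> w -> nC; rewrite phi_dc; have [e00 e01 e10 e11] := y_conjugate_weval w.
rewrite /SL2_act e00 e01 e10 e11; set M := weval gAB w.
have M10 : M 1 0 != 0.
  apply: contra_notN nC => /eqP M10; rewrite kappa_dc.
  exact: (weval_triangular lexP ltx1x lex12 AE BE gen_dc (or_introl M10)).
have SM i j : M i j \in S by apply: weval_const.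
case: v => u v /andP[/= u0 le_vu]; rewrite /y_large /=.
have lt_uyu : lty u (y * u) by rewrite -{2}[u]mul1r vleM2rE.
rewrite addrC; apply: (vlt_dominant leyP (m := y * u)).
- apply: (vle_lt_trans leyP _ lt_uyu); apply: (vleD leyP); first exact: const_mul_le.
  rewrite mulrAC; apply: (vle_trans leyP _ le_vu).
  rewrite -(vleM2rE leyP (c := y)) // divfK //.
  apply: (vle_trans leyP (const_mul_le _ (SM 0 1))).
  by rewrite [v * y]mulrC -{1}[v]mul1r (vleM2r leyP) // vltW.
- apply: (vle_lt_trans leyP _ lt_uyu).
  exact: (vle_trans leyP (const_mul_le v (SM 1 1))).
- by rewrite [y * M 1 0]mulrC -mulrA le_const_mul.
Qed.

(** Constant vectors with nonzero first coordinate are small. If (1, 0) is sent to one with zero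
    first coordinate, (1, 1) works, since the determinant forces a nonzero (0,1) entry. *)
Lemma in_ab_base g : in_ab g ->
  exists2 v, y_small v & y_small (SL2_act (phi g) v).
Proof.
case=> w ->; rewrite phi_ab; set M := weval gAB w.
have SM i j : M i j \in S by apply: weval_const.
have const_small a b : a \in S -> b \in S -> a != 0 -> y_small (a, b).
  move=> Sa Sb a0; rewrite /y_small a0 /=; apply: (vle_trans leyP (const_le Sb)).
  by case/andP: (S_unit Sa a0).
have S1 : 1 \in S := rpred1 S; have S0 : 0 \in S := rpred0 S.
have [M00|M00] := eqVneq (M 0 0) 0.
  exists (1, 1); first by rewrite const_small ?oner_eq0.
  rewrite /SL2_act /= !mulr1 M00 add0r const_small ?rpredD //.
  apply: contra_eq_neq (SL2_det M) => M01.
  by rewrite M00 M01 !mul0r subr0 eq_sym oner_eq0.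
exists (1, 0); first by rewrite const_small ?oner_eq0.
by rewrite /SL2_act /= !mulr1 !mulr0 !addr0 const_small.
Qed.

Lemma phi_inj : injective phi.
Proof.
apply: gmulf_inj => g phi_g.
have [w gE] : in_ab g.
  apply: (@amalgam_kernel _ in_ab in_dc (power_of kappa) _ _ _ _ _ S2_gen _
     (fun g => SL2_act (phi g)) (fun v => y_small v) (fun v => y_large v)).
  - by exists [::]; rewrite /weval big_nil.
  - by move=> _ _ [u ->] [v ->]; exists (u ++ v); rewrite weval_cat.
  - by move=> _ _ [u ->] [v ->]; exists (u ++ v); rewrite weval_cat.
  - exact: (@range_weval_power gen_ab).
  - by move=> h; rewrite kappa_dc; apply: (@range_weval_power gen_dc).
  - by move=> h k v; rewrite gmulfM SL2_actM.
  - by move=> v /andP[_ vv]; rewrite /y_large vv.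
  - exact: in_ab_act.
  - exact: in_dc_act.
  - exact: in_ab_base.
  - by move=> v; rewrite phi_g SL2_act1.
have w1 : weval gAB w = 1%g by rewrite -phi_ab -gE.
have [i [j gk]] : power_of kappa g.
  rewrite gE; apply: (weval_triangular lexP ltx1x lex12 AE BE gen_ab (w := w)).
  by left; rewrite w1 SL2_oneE.
(* Here [g * kappa ^+ i = kappa ^+ j]. Under [phi] this equates two powers of the commutator of [A]
   and [B], whose powers are pairwise distinct. *)
suff ij : i = j by move: gk; rewrite ij -[RHS]mul1g => /mulIg.
have phi_kappaX n : phi (kappa ^+ n)%g = ((A * B * A^-1 * B^-1) ^+ n)%g.
  rewrite gmulfXn; congr (_ ^+ n)%g.
  by rewrite -[kappa](weval_commutator gen_ab false true) phi_ab weval_commutator.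
apply: (commutator_exp_inj lexP ltx1x lex12 AE BE).
by rewrite -!phi_kappaX -gk gmulfM phi_g mul1g.
Qed.

End Injectivity.

Lemma surface_group_representation :
  exists phi : UMagmaMorphism.type S2 (SL 2 K),
    [/\ phi S2a = A, phi S2b = B, phi S2c = C & phi S2d = D] /\ injective phi.
Proof.
pose f (i : 'I_4) : SL 2 K := nth 1%g [:: A; B; C; D] i.
have f_rels : {in S2_rels, forall r, weval f r = 1%g}.
  move=> r; rewrite inE => /eqP->.
  rewrite weval_cat !weval_commutator /f /= commutator_eq.
  have -> : (D * C * D^-1 * C^-1 = (C * D * C^-1 * D^-1)^-1)%g.
    by rewrite !invgM !invgK !mulgA.
  exact: mulVg.
have [phi [[phiM phi_gen] _]] := pres_universal f_rels.
have phi1 : phi 1%g = 1%g by apply: (mulgI (phi 1%g)); rewrite -phiM !mulg1.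
pose phi' : UMagmaMorphism.type S2 (SL 2 K) :=
  HB.pack phi (isUMagmaMorphism.Build S2 (SL 2 K) phi (phi1, phiM)).
exists phi'.
have vals : [/\ phi' S2a = A, phi' S2b = B, phi' S2c = C & phi' S2d = D].
  by split; apply: phi_gen.
by split=> //; case: vals => *; apply: phi_inj.
Qed.

End SurfaceGroupRepresentation.

Lemma matrices_exist (K : fieldType) (le : rel K) (x y : K) :
  valuation_preorder le -> ~~ le x 1 -> le 1 2 -> y != 0 ->
  exists A B C D : SL 2 K,
    [/\ slval A = mxA x, slval B = mxB x, slval D = mxD x y & slval C = mxC x y] /\
    y_conjugate y A D /\ y_conjugate y B C.
Proof.
move=> leP lt1x le12 y0.
have x0 := x_neq0 leP lt1x; have x1 := subr1_x_neq0 leP lt1x.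
have q0 := cubic_neq0 leP lt1x le12.
have r0 := quartic_neq0 leP lt1x le12; have x1' := x_subr1_neq0 leP lt1x.
exists (MkSL (introT eqP (det_mxA leP lt1x))),
  (MkSL (introT eqP (det_mxB leP lt1x le12))),
  (MkSL (introT eqP (det_mxC leP lt1x le12 y0))),
  (MkSL (introT eqP (det_mxD leP lt1x y0))).
by split=> //; split; split; rewrite /= !mxE //=; field;
  rewrite ?x0 ?y0 ?x1 ?x1' ?q0 ?r0.
Qed.

(** * The x-degree and y-degree on k(x, y) *)

Section RationalFunctions.
Variable k : fieldType.
Local Notation K := (ratfun2 k).

Definition ydeg_le : rel K := @frac_le {poly {poly k}} (fun p => size p).
(* The degree in x of a polynomial in k[x][y] is the maximal degree of its
   coefficients, hence its degree after exchanging the variables. *)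
Definition xdeg_le : rel K := @frac_le {poly {poly k}} (fun p => size (swapXY p)).

Lemma ydeg_leP : valuation_preorder ydeg_le.
Proof.
apply: frac_leP => [p|p q|p q]; first exact: size_poly_eq0.
  exact: size_mul.
exact: size_polyD.
Qed.

Lemma xdeg_leP : valuation_preorder xdeg_le.
Proof.
apply: frac_leP => [p|p q p0 q0|p q].
- by rewrite size_poly_eq0 swapXY_eq0.
- by rewrite rmorphM size_mul ?swapXY_eq0.
- by rewrite raddfD size_polyD.
Qed.

(** The subfield k(x): as [y] is the outer variable, polynomials in [x] are the constants [p%:P]. *)
Definition in_kx : {pred K} := fun a =>
  `[< exists p q : {poly k}, q != 0 /\ a = tofrac p%:P / tofrac q%:P >].

Lemma ydeg_le_tofrac p q : ydeg_le (tofrac p) (tofrac q) = (size p <= size q)%N.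
Proof.
by apply: frac_le_tofrac => [r|r s]; [exact: size_poly_eq0 | exact: size_mul].
Qed.

Lemma xdeg_le_tofrac p q :
  xdeg_le (tofrac p) (tofrac q) = (size (swapXY p) <= size (swapXY q))%N.
Proof.
apply: (frac_le_tofrac (sz := fun p => size (swapXY p))) => [r|r s r0 s0].
  by rewrite size_poly_eq0 swapXY_eq0.
by rewrite rmorphM size_mul ?swapXY_eq0.
Qed.

Lemma ydeg_gt1_ratY : ~~ ydeg_le (ratY k) 1.
Proof. by rewrite -tofrac1 ydeg_le_tofrac size_polyX size_poly1. Qed.

Lemma xdeg_gt1_ratX : ~~ xdeg_le (ratX k) 1.
Proof.
rewrite -tofrac1 xdeg_le_tofrac swapXY_polyC map_polyX rmorph1.
by rewrite size_polyX size_poly1.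
Qed.

Lemma xdeg_1_le_2 : (2 : k) != 0 -> xdeg_le 1 2.
Proof.
move=> two_neq0; rewrite -tofrac1 -[2](rmorph_nat (@tofrac _)) xdeg_le_tofrac.
rewrite rmorph1 rmorph_nat size_poly1 size_poly_gt0.
by rewrite -[2]polyC_natr -polyC_natr !polyC_eq0.
Qed.

Lemma in_kx_divring_closed : divring_closed in_kx.
Proof.
split=> [|a b|a b].
- apply/asboolP; exists 1, 1.
  by rewrite oner_eq0 divff // tofrac_eq0 polyC_eq0 oner_eq0.
- move=> /asboolP[p [q [q0 ->]]] /asboolP[r [s [s0 ->]]]; apply/asboolP.
  exists (p * s - r * q), (q * s); rewrite mulf_neq0 //; split=> //.
  rewrite polyCB !polyCM tofracB !tofracM -mulNr addf_div ?mulNr //;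
  by rewrite tofrac_eq0 polyC_eq0.
- move=> /asboolP[p [q [q0 ->]]] /asboolP[r [s [s0 ->]]]; apply/asboolP.
  have [->|r0] := eqVneq r 0.
    (* Division by zero returns [0], so the quotient is represented by [0 / 1]. *)
    by exists 0, 1; rewrite oner_eq0 tofrac0 !mul0r invr0 mulr0.
  exists (p * s), (q * r); rewrite mulf_neq0 //; split=> //.
  by rewrite !polyCM !tofracM invf_div mulf_div.
Qed.

HB.instance Definition _ :=
  GRing.isDivringClosed.Build K in_kx in_kx_divring_closed.

(** Numerator and denominator are nonzero and free of [y], so both have size one. *)
Lemma in_kx_unit c : c \in in_kx -> c != 0 -> ydeg_le c 1 && ydeg_le 1 c.
Proof.
move=> /asboolP[p [q [q0 ->]]] c0.
have p0 : p != 0 by apply: contraNneq c0 => ->; rewrite tofrac0 mul0r.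
have tq0 : tofrac q%:P != 0 :> K by rewrite tofrac_eq0 polyC_eq0.
rewrite -[1](divff tq0) /ydeg_le !frac_leE ?polyC_eq0 ?size_polyC ?p0 ?q0 //.
all: by [exact: size_poly_eq0 | exact: size_mul].
Qed.

End RationalFunctions.

Theorem theorem8p4 (p : nat) (p_pr : prime p) (p_odd : odd p) :
  let x := ratX 'F_p in
  let y := ratY 'F_p in
  exists A B C D : SL 2 (ratfun2 'F_p),
  [/\ [/\ slval A =
            mx2 ((1 - 2 * x ^+ 2 - 2 * x ^+ 3) / (x * (x - 1)))
                ((- 1 + 2 * x ^+ 2 + x ^+ 3 + x ^+ 4) / (x ^+ 3 * (1 - x)))
                1
                (1 / x ^+ 2),
          slval B =
            mx2 ((x ^+ 2 - 1) / (x - 2 * x ^+ 3 - 2 * x ^+ 4))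
                ((1 + 2 * x - x ^+ 2 - 3 * x ^+ 3 - 2 * x ^+ 4)
                   / (x ^+ 2 * (2 * x ^+ 3 + 2 * x ^+ 2 - 1)))
                x
                (1 + x),
          slval D =
            mx2 ((1 - 2 * x ^+ 2 - 2 * x ^+ 3) / (x * (x - 1)))
                ((- 1 + 2 * x ^+ 2 + x ^+ 3 + x ^+ 4)
                   / (y * x ^+ 3 * (1 - x)))
                y
                (1 / x ^+ 2) &
          slval C =
            mx2 ((x ^+ 2 - 1) / (x - 2 * x ^+ 3 - 2 * x ^+ 4))
                ((1 + 2 * x - x ^+ 2 - 3 * x ^+ 3 - 2 * x ^+ 4)
                   / (y * x ^+ 2 * (2 * x ^+ 3 + 2 * x ^+ 2 - 1)))
                (y * x)
                (1 + x)],
      (A * B * A^-1 * B^-1 = D * C * D^-1 * C^-1)%g &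
      exists phi : UMagmaMorphism.type S2 (SL 2 (ratfun2 'F_p)),
        [/\ phi S2a = A, phi S2b = B, phi S2c = C & phi S2d = D]
        /\ injective phi].
Proof.
move=> x y.
have lexP := xdeg_leP 'F_p; have leyP := ydeg_leP 'F_p.
have two_neq0 : (2 : 'F_p) != 0.
  rewrite -(dvdn_pcharf (pchar_Fp p_pr)).
  by apply: contraTN p_odd; rewrite dvdn_prime2 // => /eqP->.
have lt1x := xdeg_gt1_ratX 'F_p; have lt1y := ydeg_gt1_ratY 'F_p.
have le12 := xdeg_1_le_2 two_neq0.
have y0 : y != 0 := vlt1_neq0 leyP lt1y.
have Sx : x \in @in_kx 'F_p.
  by apply/asboolP; exists 'X, 1; rewrite oner_eq0 tofrac1 divr1.
have [A [B [C [D [[AE BE DE CE] [AD BC]]]]]] := matrices_exist lexP lt1x le12 y0.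
exists A, B, C, D; split; first by split.
  exact: (commutator_eq lexP leyP lt1x le12 lt1y AE BE AD BC).
exact: (surface_group_representation lexP leyP Sx (@in_kx_unit _) lt1x le12 lt1y
  AE BE AD BC).
Qed.
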